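(* Consider the average system $$\frac{d\hat G_{\mathrm{av}}(\tau)}{d\tau}=\frac1\omega HK\hat G_{\mathrm{av}}(\tau)-\frac1\omega H\,\psi(u_{\mathrm{av}}(\tau)),\qquad u_{\mathrm{av}}=K\hat G_{\mathrm{av}},$$ where $\omega>0$, $H\in\mathbb R^{n\times n}$ is the (symmetric, positive definite or negative definite) Hessian matrix, and $\psi$ is the dead-zone nonlinearity with saturation limits $\overline u_1,\dots,\overline u_n>0$. Let a scalar $\eta>0$, a control gain $K\in\mathbb R^{n\times n}$ and symmetric positive definite matrices $P,Q\in\mathbb R^{n\times n}$ be given. If there exist a matrix $L\in\mathbb R^{n\times n}$ and a diagonal positive definite matrix $U\in\mathbb R^{n\times n}$ such that $$\begin{bmatrix} K^\top HP+PHK+2\eta P & L^\top U-PH\\ UL-HP & -2U\end{bmatrix}<0,$$ then the origin of the average system is exponentially stable.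
   Context: The saturation function acts element-wise: for $u\in\mathbb R^n$, $\mathrm{sat}(u)_\ell=\mathrm{sign}(u_\ell)\min(|u_\ell|,\overline u_\ell)$, $\ell=1,\dots,n$, with given limits $\overline u_\ell>0$. The dead-zone nonlinearity is $\psi(u)=u-\mathrm{sat}(u)$, so the average system is equivalently $\frac{d\hat G_{\mathrm{av}}}{d\tau}=\frac1\omega H\,\mathrm{sat}(K\hat G_{\mathrm{av}})$. For a matrix $X$, $X<0$ (resp. $X>0$) means $X$ is symmetric negative (resp. positive) definite. $H$ is the Hessian of a quadratic map; it is assumed positive definite if a minimum is sought and negative definite if a maximum is sought. The origin is exponentially stable in the standard sense: there exist $r,c,\lambda>0$ such that $\|\hat G_{\mathrm{av}}(0)\|\le r$ implies $\|\hat G_{\mathrm{av}}(\tau)\|\le c\,e^{-\lambda\tau}\|\hat G_{\mathrm{av}}(0)\|$ for all $\tau\ge0$. *)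

(* Defs.v *)
From HB Require Import structures.
From mathcomp Require Import all_boot all_order all_algebra.
From mathcomp Require Import all_classical all_reals all_analysis.

Set Implicit Arguments.
Unset Strict Implicit.
Unset Printing Implicit Defensive.

Import Order.TTheory GRing.Theory Num.Theory.
Import numFieldNormedType.Exports.

Local Open Scope classical_set_scope.
Local Open Scope ring_scope.

Definition posdefmx (R : realType) (n : nat) (X : 'M[R]_n) : Prop :=
  X^T = X /\ forall x : 'cV[R]_n, x != 0 -> 0 < (x^T *m X *m x) 0 0.

Definition negdefmx (R : realType) (n : nat) (X : 'M[R]_n) : Prop :=
  X^T = X /\ forall x : 'cV[R]_n, x != 0 -> (x^T *m X *m x) 0 0 < 0.

Definition sat (R : realType) (n : nat) (ubar u : 'cV[R]_n) : 'cV[R]_n :=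
  \col_l (Num.sg (u l 0) * Num.min `|u l 0| (ubar l 0)).

Definition deadzone (R : realType) (n : nat) (ubar u : 'cV[R]_n) : 'cV[R]_n :=
  u - sat ubar u.

Definition average_field (R : realType) (n : nat) (omega : R)
    (H K : 'M[R]_n) (ubar G : 'cV[R]_n) : 'cV[R]_n :=
  omega^-1 *: (H *m K *m G) - omega^-1 *: (H *m deadzone ubar (K *m G)).

(* The library norm on matrices is the sup norm. *)
Definition euclnorm (R : realType) (n : nat) (x : 'cV[R]_n) : R :=
  Num.sqrt (\sum_(i < n) x i 0 ^+ 2).

(* A trajectory lives on [0, +oo[; its values at negative times are junk, so
   only one-sided continuity is required at time 0. *)
Definition is_solution (R : realType) (n : nat)
    (f : 'cV[R]_n -> 'cV[R]_n) (G : R -> 'cV[R]_n) : Prop :=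
  {within `[0, +oo[, continuous G} /\
  forall t : R, 0 < t -> is_derive t 1 G (f (G t)).

Definition origin_exp_stable (R : realType) (n : nat)
    (f : 'cV[R]_n -> 'cV[R]_n) : Prop :=
  exists r c lambda : R, [/\ 0 < r, 0 < c, 0 < lambda &
    forall G : R -> 'cV[R]_n, is_solution f G -> euclnorm (G 0) <= r ->
      forall t : R, 0 <= t ->
        euclnorm (G t) <= c * expR (- lambda * t) * euclnorm (G 0)].

(* Main.v *)
Require Import Defs.
From HB Require Import structures.
From mathcomp Require Import all_boot all_order all_algebra.
From mathcomp Require Import all_classical all_reals all_analysis.
From mathcomp Require Import ring lra.

Set Implicit Arguments.
Unset Strict Implicit.
Unset Printing Implicit Defensive.

Import Order.TTheory GRing.Theory Num.Theory.
Import numFieldNormedType.Exports.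

Local Open Scope ring_scope.

(** The Lyapunov function is the quadratic form V(x) = x^T P x.  Exponential
    stability of the origin is a local property, and near the origin the control
    does not saturate, so the dead zone vanishes and the average system is linear,
    with matrix omega^-1 H K.  There the derivative of V along a trajectory is
    omega^-1 x^T (K^T H P + P H K) x, and the upper left block of the matrix
    inequality bounds it by - (2 eta / omega) V(x).

    The neighbourhood has to be a sublevel set of V, because that is what the decay
    of V makes invariant.  The Cauchy-Schwarz inequality for the inner product
    given by P ([sqr_mul_row_le]) bounds the square of every linear functional of
    x by a multiple of V(x).  Applied to the rows of K it yields a level rho below
    which nothing saturates ([unsaturated_sublevel]); applied to the coordinates it
    yields the comparison of V with the Euclidean norm ([sqr_norm_le_qform]),
    without any compactness argument on the sphere.

    Along a trajectory that starts below rho, V cannot climb back to rho: before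
    the first time at which it would, V is nonincreasing.  Hence the differential
    inequality V' <= - mu V holds at all times, and exp(mu t) V is nonincreasing
    ([trapped_exponential_decay]).  Comparing V with the norm at both ends gives
    the exponential bound ([qform_exp_stable]). *)

(** * Quadratic forms of positive definite matrices *)

Definition qform (R : realType) (n : nat) (P : 'M[R]_n) (x : 'cV[R]_n) : R :=
  (x^T *m P *m x) 0 0.

Lemma qform_ge0 (R : realType) (n : nat) (P : 'M[R]_n) (x : 'cV[R]_n) :
  posdefmx P -> 0 <= qform P x.
Proof.
move=> [_ Ppos]; have [->|x0] := eqVneq x 0; last exact/ltW/Ppos.
by rewrite /qform mulmx0 mxE.
Qed.

Lemma posdefmx_unit (R : realType) (n : nat) (P : 'M[R]_n) :
  posdefmx P -> P \in unitmx.
Proof.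
move=> [_ Ppos]; rewrite unitmxE unitfE; apply/det0P => -[v v0 vP0].
have := Ppos v^T; rewrite trmx_eq0 trmxK vP0 mul0mx mxE ltxx.
by move=> /(_ v0).
Qed.

(** Cauchy-Schwarz for the inner product y^T P x: the functional w is represented
    by y = P^-1 w^T, and the first factor is the squared P-length of y. *)
Lemma sqr_mul_row_le (R : realType) (n : nat) (P : 'M[R]_n) (w : 'rV[R]_n)
    (x : 'cV[R]_n) :
  posdefmx P ->
  ((w *m x) 0 0) ^+ 2 <= qform P (invmx P *m w^T) * qform P x.
Proof.
move=> hP; have [PT Ppos] := hP; have Punit := posdefmx_unit hP.
set y := invmx P *m w^T.
have ywE : y^T *m P = w.
  by rewrite -[LHS]trmxK trmx_mul trmxK PT mulKVmx // trmxK.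
clearbody y.
have xPy : x^T *m P *m y = (w *m x)^T.
  by rewrite trmx_mul -ywE trmx_mul trmxK PT mulmxA.
have [y0|yn0] := eqVneq y 0.
  by rewrite -ywE y0 trmx0 !mul0mx mxE expr0n mulr_ge0 ?qform_ge0.
have cpos : 0 < qform P y := Ppos _ yn0.
set c := qform P y; set s := (w *m x) 0 0.
(* Up to the factor c, this combination is the component of x orthogonal to y. *)
have : 0 <= qform P (c *: x - s *: y) by exact: qform_ge0.
have -> : qform P (c *: x - s *: y) = c * (c * qform P x - s ^+ 2).
  have zT : (c *: x - s *: y)^T = c *: x^T - s *: y^T.
    by rewrite linearB /= !linearZ.
  rewrite /qform zT !mulmxBl !mulmxBr -!scalemxAl -!scalemxAr.
  have wyE : w *m y = c%:M by rewrite -ywE [LHS]mx11_scalar.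
  have wxE : w *m x = s%:M by rewrite [LHS]mx11_scalar.
  rewrite ywE xPy wyE wxE tr_scalar_mx [x^T *m P *m x]mx11_scalar -/(qform P x).
  rewrite !mxE !eqxx !mulr1n; ring.
by rewrite pmulr_rge0 // subr_ge0.
Qed.

(** The constant is the trace of P^-1: each coordinate of x is a functional, to
    which the Cauchy-Schwarz bound applies. *)
Lemma sqr_norm_le_qform (R : realType) (n : nat) (P : 'M[R]_n) :
  posdefmx P ->
  exists2 a, 0 <= a & forall x : 'cV[R]_n,
    \sum_i x i 0 ^+ 2 <= a * qform P x.
Proof.
move=> hP; exists (\sum_i qform P (invmx P *m (row i 1%:M)^T)).
  by apply: sumr_ge0 => i _; exact: qform_ge0.
move=> x; rewrite mulr_suml; apply: ler_sum => i _.
have -> : x i 0 = (row i 1%:M *m x) 0 0 by rewrite -row_mul mul1mx [RHS]mxE.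
exact: sqr_mul_row_le.
Qed.

Lemma qform_le_sqr_norm (R : realType) (n : nat) (P : 'M[R]_n) (x : 'cV[R]_n) :
  qform P x <= (\sum_i \sum_j `|P i j|) * \sum_i x i 0 ^+ 2.
Proof.
have xle (i : 'I_n) : x i 0 ^+ 2 <= \sum_k x k 0 ^+ 2.
  by rewrite (bigD1 i) //= lerDl sumr_ge0 // => k _; exact: sqr_ge0.
rewrite /qform mxE exchange_big mulr_suml; apply: ler_sum => j _ /=.
rewrite mxE 2!mulr_suml; apply: ler_sum => i _; rewrite mxE.
rewrite (le_trans (ler_norm _)) // !normrM mulrAC mulrC ler_wpM2l //.
have := xle i; have := xle j; rewrite -(real_normK (num_real (x i 0))).
rewrite -(real_normK (num_real (x j 0))).
have := sqr_ge0 (`|x i 0| - `|x j 0|).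
rewrite sqrrB; lra.
Qed.

Lemma negdefmx_ul_block_le0 (R : realType) (m n : nat) (A : 'M[R]_m) (B : 'M[R]_(m, n))
    (C : 'M[R]_(n, m)) (D : 'M[R]_n) (x : 'cV[R]_m) :
  negdefmx (block_mx A B C D) -> qform A x <= 0.
Proof.
move=> [_ neg]; have [->|x0] := eqVneq x 0.
  by rewrite /qform mulmx0 mxE.
have := neg (col_mx x 0); rewrite col_mx_eq0 (negPf x0) /= => /(_ isT) /ltW.
by rewrite tr_col_mx trmx0 mul_row_block !mul0mx !addr0 mul_row_col mulmx0 addr0.
Qed.

(** * Trajectories and scalar differential inequalities *)

Lemma is_derive_qform (R : realType) (n : nat) (P : 'M[R]_n)
    (G : R -> 'cV[R]_n) (t : R) (d : 'cV[R]_n) :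
  is_derive t 1 G d ->
  is_derive t 1 (fun s => qform P (G s))
    ((d^T *m P *m G t + (G t)^T *m P *m d) 0 0).
Proof.
move=> [dG <-].
have dGi (i : 'I_n) :
    is_derive t (1 : R) (fun s => G s i 0) (('D_1 G t) i 0).
  apply: DeriveDef; first by have /derivable_mxP := dG; exact.
  by rewrite derive_mx // mxE.
have -> : (fun s => qform P (G s)) =
    \sum_j (\sum_i (fun s => G s i 0) * cst (P i j)) * (fun s => G s j 0).
  apply/funext => s; rewrite fct_sumE /qform mxE.
  apply: eq_bigr => j _; rewrite mxE /= fct_sumE; congr (_ * _).
  by apply: eq_bigr => i _; rewrite mxE.
apply: is_derive_eq.
rewrite mxE [X in _ = X + _]mxE [X in _ = _ + X]mxE -big_split /=.
apply: eq_bigr => j _.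
rewrite !mxE fct_sumE addrC; congr (_ + _).
  by congr (_ * _); apply: eq_bigr => i _; rewrite mxE.
rewrite [LHS]mulrC; congr (_ * _); apply: eq_bigr => i _.
by rewrite mxE scaler0 add0r [LHS]mulrC.
Qed.

(** An arbitrary topological space T as source covers continuity within a subset,
    which is continuity on the corresponding subspace. *)
Lemma continuous_qform (R : realType) (n : nat) (P : 'M[R]_n)
    (T : topologicalType) (G : T -> 'cV[R]_n) :
  continuous G -> continuous (fun s => qform P (G s)).
Proof.
move=> Gc.
have Gic (i : 'I_n) : continuous (fun s => G s i 0).
  move=> s; apply: (@continuous_comp _ _ _ G (fun x : 'cV[R]_n => x i 0)).
    exact: Gc.
  exact: coord_continuous.
have -> : (fun s => qform P (G s)) =
    (fun s => \sum_j (\sum_i G s i 0 * P i j) * G s j 0).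
  apply/funext => s; rewrite /qform mxE; apply: eq_bigr => j _.
  by rewrite mxE; congr (_ * _); apply: eq_bigr => i _; rewrite mxE.
have sumc := @continuous_big R 'I_n +%R 0 xpredT add_continuous.
have colc (j : 'I_n) : continuous (fun s => \sum_i G s i 0 * P i j).
  by apply: (sumc) => i _ s; apply: cvgM; [exact: Gic|exact: cvg_cst].
by apply: (sumc) => j _ s; apply: cvgM; [exact: colc|exact: Gic].
Qed.

(** The times in [0, T] at which v has reached rho form a nonempty compact set,
    which therefore has a least element. *)
Lemma first_hitting_time (R : realType) (v : R -> R) (rho T : R) :
  {within `[0, T], continuous v}%classic -> 0 <= T -> rho <= v T ->
  exists s, [/\ 0 <= s <= T, rho <= v s &
    forall t : R, 0 <= t < s -> v t < rho].
Proof.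
move=> vc T0 vT.
have : closed (v @^-1` [set y | rho <= y]%classic
    : set (subspace `[0, T]%classic)).
  by apply: preimage_closed; [move=> ? _; exact: vc|exact: closed_ge].
move=> /closed_subspaceP [V Vclosed VE].
have SE (t : R) : (V `&` `[0, T]%classic)%classic t <->
    (0 <= t <= T) /\ rho <= v t.
  by rewrite VE /= in_itv /=; tauto.
have Vne : (V `&` `[0, T] !=set0)%classic.
  by exists T; apply/SE; rewrite T0 lexx.
have Vcompact : compact (V `&` `[0, T])%classic.
  by rewrite setIC; apply: compact_closedI => //; exact: segment_compact.
have idc : {within V `&` `[0, T], continuous (idfun : R -> R)}%classic.
  by apply: continuous_subspaceT => x; exact: cvg_id.
have [s] := compact_EVT_min Vne Vcompact idc.
rewrite inE => /SE [sT vs] smin; exists s; split=> // t /andP [t0 ts].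
rewrite ltNge; apply/negP => vt.
have : t \in (V `&` `[0, T])%classic.
  by rewrite inE; apply/SE; rewrite t0 vt (le_trans (ltW ts)) //; case/andP: sT.
by move=> /smin /=; rewrite leNgt ts.
Qed.

(** The differential inequality is only known below the level rho, so the first
    step is that v never gets there: up to a first hitting time v would be
    nonincreasing, hence at most v 0 < rho at that time.  Multiplying by the
    integrating factor exp(mu t) then concludes. *)
Lemma trapped_exponential_decay (R : realType) (v dv : R -> R) (rho mu : R) :
  {within `[0, +oo[, continuous v}%classic ->
  (forall t : R, 0 < t -> is_derive t 1 v (dv t)) ->
  (forall t : R, 0 < t -> v t <= rho -> dv t <= - mu * v t) ->
  (forall t, 0 <= v t) -> 0 <= mu -> v 0 < rho ->
  forall t : R, 0 <= t -> v t <= expR (- mu * t) * v 0.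
Proof.
move=> vc vd dvle v0 mu0 vrho.
have vcT (T : R) : {within `[0, T], continuous v}%classic.
  by apply: continuous_subspaceW vc => x /=; rewrite !in_itv /= => /andP [->].
have trapped t : 0 <= t -> v t < rho.
  move=> t0; rewrite ltNge; apply/negP => vt.
  have [s [/andP [s0 st] vs below]] := first_hitting_time (vcT t) t0 vt.
  suff : v s <= v 0 by rewrite leNgt (lt_le_trans vrho vs).
  apply: (@ler0_derive1_nincr _ v 0 s) => // x; rewrite in_itv /= => /andP [x0 xs].
    by have [] := vd _ x0.
  rewrite derive1E; have [_ ->] := vd _ x0.
  have vx : v x < rho by rewrite below // xs ltW.
  by rewrite (le_trans (dvle _ x0 (ltW vx))) // mulNr oppr_le0 mulr_ge0.
move=> t t0.
pose g (x : R) := expR (mu * x) * v x.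
have gd (x : R) : 0 < x ->
    is_derive x 1 g (expR (mu * x) * dv x + v x * (expR (mu * x) * mu)).
  move=> x0; have vdx := vd _ x0; apply: is_derive_eq.
  by rewrite /GRing.scale /= mulr1.
have gle : g t <= g 0.
  apply: (@ler0_derive1_nincry _ g 0) => //.
  - by move=> x; rewrite in_itv /= andbT => /gd [].
  - move=> x; rewrite in_itv /= andbT => x0; rewrite derive1E.
    have [_ ->] := gd _ x0.
    have := dvle _ x0 (ltW (trapped _ (ltW x0))).
    rewrite [v x * _]mulrC -mulrA -mulrDr pmulr_rle0 ?expR_gt0 //; lra.
  - move=> x; apply: cvgM; last exact: vc.
    apply: continuous_subspaceT => y.
    apply: continuous_comp; last exact: continuous_expR.
    by apply: cvgM; [exact: cvg_cst|exact: cvg_id].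
move: gle; rewrite /g mulr0 expR0 mul1r mulNr expRN => gle.
by rewrite ler_pdivlMl ?expR_gt0.
Qed.

(** * Stability of the saturated system *)

Lemma deadzone_eq0 (R : realType) (n : nat) (ubar u : 'cV[R]_n) :
  (forall l, `|u l 0| <= ubar l 0) -> deadzone ubar u = 0.
Proof.
move=> ule; apply/colP => l; rewrite !mxE.
by rewrite min_l // -numEsg subrr.
Qed.

(** By Cauchy-Schwarz, coordinate l of K x has square at most k_l V(x), where
    V = qform P and k_l depends only on P and row l of K. *)
Lemma unsaturated_sublevel (R : realType) (n : nat) (P K : 'M[R]_n)
    (ubar : 'cV[R]_n) :
  posdefmx P -> (forall l, 0 < ubar l 0) ->
  exists2 rho, 0 < rho & forall x, qform P x <= rho ->
    deadzone ubar (K *m x) = 0.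
Proof.
move=> hP ubar0.
pose k l := qform P (invmx P *m (row l K)^T).
have k0 l : 0 <= k l / ubar l 0 ^+ 2.
  by rewrite divr_ge0 ?qform_ge0 ?sqr_ge0.
have sum0 : 0 <= \sum_l k l / ubar l 0 ^+ 2 by exact: sumr_ge0.
(* This level plays the role of the minimum over l of ubar_l^2 / k_l, with
   neither a minimum over a possibly empty index set nor a division by k_l. *)
exists (1 + \sum_l k l / ubar l 0 ^+ 2)^-1; first by rewrite invr_gt0; lra.
move=> x xle; apply: deadzone_eq0 => l.
rewrite -[_ <= _]ler_sqr ?nnegrE ?normr_ge0 ?(ltW (ubar0 l)) //.
rewrite real_normK ?num_real //.
have -> : (K *m x) l 0 = (row l K *m x) 0 0 by rewrite -row_mul [RHS]mxE.
apply: (le_trans (sqr_mul_row_le (row l K) x hP)).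
have ul2 : 0 < ubar l 0 ^+ 2 by rewrite exprn_gt0.
rewrite -/(k l) -[leRHS]mul1r -ler_pdivrMr // mulrAC.
rewrite (le_trans (ler_wpM2l (k0 l) xle)) // ler_pdivrMr ?mul1r; last by lra.
by rewrite (bigD1 l) //= addrCA lerDl addr_ge0 // sumr_ge0.
Qed.

(** A local Lyapunov theorem with a quadratic Lyapunov function.  With
    |x|^2 <= a V(x) and V(x) <= b |x|^2, the norm decays at half the rate of V and
    the overshoot is the square root of a b, which 1 + a b dominates. *)
Lemma qform_exp_stable (R : realType) (n : nat) (f : 'cV[R]_n -> 'cV[R]_n)
    (P : 'M[R]_n) (rho mu : R) :
  posdefmx P -> 0 < rho -> 0 < mu ->
  (forall x, qform P x <= rho ->
     ((f x)^T *m P *m x + x^T *m P *m f x) 0 0 <= - mu * qform P x) ->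
  origin_exp_stable f.
Proof.
move=> hP rho0 mu0 decr.
have [a a0 aP] := sqr_norm_le_qform hP.
set b := \sum_i \sum_j `|P i j|.
have b0 : 0 <= b by apply: sumr_ge0 => i _; exact: sumr_ge0.
have normE (x : 'cV[R]_n) : euclnorm x ^+ 2 = \sum_i x i 0 ^+ 2.
  by rewrite sqr_sqrtr // sumr_ge0 // => i _; exact: sqr_ge0.
have b1 : 0 < b + 1 by lra.
have ab0 : 0 <= a * b by rewrite mulr_ge0.
(* With this radius b r^2 stays strictly below rho, also when b = 0. *)
exists (Num.sqrt (rho / (b + 1))), (1 + a * b), (mu / 2).
split; [by rewrite sqrtr_gt0 divr_gt0 | lra | lra |].
move=> G [Gc Gd] G0r t t0.
have qG0 : qform P (G 0) < rho.
  apply: (le_lt_trans (qform_le_sqr_norm _ _)); rewrite -/b -normE.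
  have : euclnorm (G 0) ^+ 2 <= rho / (b + 1).
    rewrite -[leRHS]sqr_sqrtr ?(ltW (divr_gt0 rho0 b1)) //.
    by rewrite ler_sqr ?nnegrE ?sqrtr_ge0.
  move=> /(ler_wpM2l b0) /le_lt_trans; apply.
  by rewrite mulrCA gtr_pMr // ltr_pdivrMr // mul1r ltrDl.
have qc : {within `[0, +oo[, continuous (fun s => qform P (G s))}%classic.
  exact: continuous_qform.
have qdecay := trapped_exponential_decay qc
  (fun t t0 => is_derive_qform P (Gd t t0)) (fun t _ => @decr (G t))
  (fun t => qform_ge0 (G t) hP) (ltW mu0) qG0 t0.
rewrite -[_ <= _]ler_sqr ?nnegrE ?mulr_ge0 ?sqrtr_ge0 ?expR_ge0 //; last lra.
rewrite normE (le_trans (aP _)) // (le_trans (ler_wpM2l a0 qdecay)) //.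
rewrite !exprMn -expRM_natl.
have -> : 2%:R * (- (mu / 2) * t) = - mu * t by lra.
rewrite mulrCA mulrAC [leRHS]mulrC ler_wpM2l ?expR_ge0 //.
rewrite (le_trans (ler_wpM2l a0 (qform_le_sqr_norm _ _))) // -/b -normE.
rewrite mulrA ler_wpM2r ?sqr_ge0 //.
rewrite sqrrD expr1n mul1r; have := sqr_ge0 (a * b); lra.
Qed.

Theorem theorem1 (R : realType) (n : nat) (omega : R) (H : 'M[R]_n)
    (ubar : 'cV[R]_n) (eta : R) (K P Q : 'M[R]_n)
    (homega : 0 < omega)
    (hH : posdefmx H \/ negdefmx H)
    (hubar : forall l : 'I_n, 0 < ubar l 0)
    (heta : 0 < eta)
    (hP : posdefmx P)
    (hQ : posdefmx Q)
    (hLMI : exists L U : 'M[R]_n, [/\ is_diag_mx U, posdefmx U &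
      negdefmx (block_mx
        (K^T *m H *m P + P *m H *m K + (2 * eta) *: P) (L^T *m U - P *m H)
        (U *m L - H *m P)                              (- (2 *: U)))]) :
  origin_exp_stable (average_field omega H K ubar).
Proof.
have HT : H^T = H by case: hH => -[].
have [L [U [_ _ lmi]]] := hLMI.
have [rho rho0 unsat] := unsaturated_sublevel K hP hubar.
have mu0 : 0 < 2 * eta / omega by rewrite divr_gt0 ?mulr_gt0.
apply: (qform_exp_stable hP rho0 mu0) => x /unsat xunsat.
rewrite /average_field xunsat mulmx0 scaler0 subr0.
rewrite linearZ /= !trmx_mul HT -scalemxAr -!scalemxAl -scalerDr mxE.
have := negdefmx_ul_block_le0 x lmi.
rewrite /qform 2!mulmxDr 2!mulmxDl -!scalemxAr -!scalemxAl !mulmxA.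
rewrite mxE [in X in _ + X]mxE => lmix.
rewrite -[_ * eta / omega]mulrC mulNr -mulrA -mulrN.
by rewrite ler_wpM2l ?invr_ge0 ?(ltW homega) //; lra.
Qed.
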